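(* Let $G\in\mathfrak{Gr}(n,k)$ with $k\ge 2$, and let $s$ be an integer with $$\frac{\log\binom{n+1}{2}}{\log\bigl(n/(k-1)\bigr)}<s\le n.$$ Then there exists an identifying set of $s$ vertices of $G$.
   Context: All graphs are finite, simple and undirected. For a graph $G=(V,E)$ and $x\in V$, $N[x]=\{x\}\cup\{y: xy\in E\}$. A set $C\subseteq V$ is identifying if $N[x]\cap C\ne\emptyset$ for every $x\in V$ and $N[x]\cap C\neq N[y]\cap C$ for all distinct $x,y\in V$. For $n\ge k\ge1$, $\mathfrak{Gr}(n,k)$ is the set of graphs on $n$ vertices in which every $k$-element subset of vertices is identifying. *)

(* Defs.v *)
From mathcomp Require Import all_boot.

Set Implicit Arguments.
Unset Strict Implicit.
Unset Printing Implicit Defensive.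

Record sgraph (V : finType) := SGraph {
  adj :> rel V;
  adj_sym : symmetric adj;
  adj_irrefl : irreflexive adj
}.

Section Identifying.
Variables (V : finType) (G : sgraph V).

Definition closed_nbhd (x : V) : {set V} := x |: [set y | G x y].

Definition identifying (C : {set V}) : Prop :=
  (forall x, closed_nbhd x :&: C <> set0) /\
  (forall x y, x <> y -> closed_nbhd x :&: C <> closed_nbhd y :&: C).

(* Membership in Gr(n, k). The conjunct [1 <= k <= n] is the range in which
   Gr(n, k) is defined; without it the last conjunct would be vacuous for
   k > n. *)
Definition in_Gr (n k : nat) : Prop :=
  [/\ 1 <= k <= n,
      #|V| = n
    & forall C : {set V}, #|C| = k -> identifying C].

End Identifying.

(* Main.v *)
(** A set is identifying iff it meets every closed neighbourhood and every
symmetric difference of two of them, that is, C(n+1, 2) sets. If every k-set is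
identifying then each of these misses at most k - 1 vertices, so a uniformly
random s-tuple of vertices avoids a given one of them with probability at most
((k - 1) / n)^s. By the union bound some s-tuple meets all of them as soon as
C(n+1, 2) ((k - 1) / n)^s < 1; its at most s entries extend to an s-set. *)

Require Import Defs.
From mathcomp Require Import all_boot all_order all_algebra.
From mathcomp Require Import reals exp.

Set Implicit Arguments.
Unset Strict Implicit.
Unset Printing Implicit Defensive.

Import Order.TTheory GRing.Theory Num.Theory.
Local Open Scope ring_scope.

Lemma exists_card_between (T : finType) (D E : {set T}) (m : nat) :
    D \subset E -> (#|D| <= m <= #|E|)%N ->
  exists C : {set T}, [/\ D \subset C, C \subset E & #|C| = m].
Proof.
move=> sDE /andP[leDm lemE].
have /card_gt0P[A] :
    (0 < #|[set A : {set T} | A \subset E :\: D & #|A| == (m - #|D|)%N]|)%N.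
  by rewrite cards_draws bin_gt0 cardsDS // leq_sub2r.
rewrite inE => /andP[sAED /eqP cardA].
have [sAE disAD] := subsetDP sAED.
exists (D :|: A); split; first exact: subsetUl.
  by rewrite subUset sDE.
by rewrite cardsU setIC (disjoint_setI0 disAD) cards0 subn0 cardA subnKC.
Qed.

(** The maps from ['I_s] to [V] that avoid one [T i] are those into its complement, at most [m ^ s]
    of them, so the strict inequality leaves a map whose image meets every [T i]. *)
Lemma exists_hitting_set (I V : finType) (P : {set I}) (T : I -> {set V})
    (m s : nat) :
    (forall i, i \in P -> #|~: T i| <= m)%N ->
    (#|P| * m ^ s < #|V| ^ s)%N -> (s <= #|V|)%N ->
  exists2 C : {set V}, #|C| = s & forall i, i \in P -> T i :&: C != set0.
Proof.
move=> leTm ltPV lesV.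
pose avoid i := [set f : {ffun 'I_s -> V} | f \in ffun_on (mem (~: T i))].
have card_avoid : (#|\bigcup_(i in P) avoid i| <= #|P| * m ^ s)%N.
  apply: (@leq_trans (\sum_(i in P) #|avoid i|)).
    elim/big_ind2: _ => [|A a B b leA leB|//]; first by rewrite cards0.
    by rewrite (leq_trans (leq_card_setU _ _)) ?leq_add.
  rewrite -sum_nat_const; apply: leq_sum => i iP.
  rewrite cardsE card_ffun_on card_ord.
  (* Comparing bases needs a positive exponent; for [s = 0] both powers are 1. *)
  by case: (s) => // s'; rewrite leq_exp2r ?leTm.
have /card_gt0P[f] : (0 < #|~: \bigcup_(i in P) avoid i|)%N.
  rewrite cardsCs setCK subn_gt0 card_ffun card_ord.
  exact: leq_ltn_trans card_avoid ltPV.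
rewrite inE => /bigcupP fP.
pose D := [set f j | j : 'I_s].
(* [f] need not be injective, so [D] may have fewer than [s] elements; enlarging it keeps every
   intersection nonempty. *)
have [|C [sDC _ cardC]] := @exists_card_between V D setT s (subsetT _).
  by rewrite cardsT lesV andbT -[leqRHS]card_ord leq_imset_card.
exists C => // i iP; apply/negP => /eqP TC0.
case: fP; exists i => //; rewrite inE; apply/ffun_onP => j.
rewrite inE; apply/negP => fjT.
suff: f j \in T i :&: C by rewrite TC0 inE.
by rewrite inE fjT (subsetP sDC) ?imset_f.
Qed.

Section Separators.
Variables (V : finType) (G : sgraph V).

(* Treats both families at once: [N[x]] for [A = {x}], and the symmetric
   difference of [N[x]] and [N[y]] for [A = {x, y}]. *)
Definition separators (A : {set V}) : {set V} :=
  [set z | \sum_(x in A) (z \in closed_nbhd G x) == 1]%N.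

Lemma separators1 x : separators [set x] = closed_nbhd G x.
Proof. by apply/setP => z; rewrite inE big_set1 eqb1. Qed.

Lemma in_separators2 x y z : x != y ->
  (z \in separators [set x; y]) =
  ((z \in closed_nbhd G x) != (z \in closed_nbhd G y)).
Proof.
move=> nxy; rewrite in_set big_setU1 ?in_set1 //= big_set1.
by case: (z \in closed_nbhd G x); case: (z \in closed_nbhd G y).
Qed.

(** Singletons [A] express domination and pairs express separation: two traces on [C] differ exactly
    when some vertex of [C] lies in only one of the two closed neighbourhoods. *)
Lemma identifyingP (C : {set V}) :
  identifying G C <->
  (forall A : {set V}, (0 < #|A| <= 2)%N -> separators A :&: C != set0).
Proof.
split=> [[dom sep] A | hit].
  rewrite [(_ <= 2)%N]leq_eqVlt ltnS andb_orr orbC -eqn_leq [1%N == _]eq_sym.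
  case/orP=> [/cards1P[x ->] | /andP[_ /cards2P[x [y [nxy ->]]]]].
    by rewrite separators1; apply/eqP/dom.
  apply/eqP => SC0; case: (sep x y); first exact/eqP.
  apply/setP => z; have := in_set0 z; rewrite -SC0 !in_setI in_separators2 //.
  by case: (z \in closed_nbhd G x); case: (z \in closed_nbhd G y); case: (z \in C).
split=> [x | x y /eqP nxy eqC].
  by apply/eqP; rewrite -separators1; apply: hit; rewrite cards1.
have /set0Pn[z] : separators [set x; y] :&: C != set0.
  by apply: hit; rewrite cards2 nxy.
move/setP/(_ z): eqC; rewrite !in_setI in_separators2 //.
by case: (z \in closed_nbhd G x); case: (z \in closed_nbhd G y); case: (z \in C).
Qed.

(** Otherwise the complement would contain a [k]-set, which is identifying by hypothesis and yet
    misses [separators A]. *)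
Lemma card_separatorsC n k (A : {set V}) :
  in_Gr G n k -> (0 < #|A| <= 2)%N -> (#|~: separators A| < k)%N.
Proof.
move=> [_ _ idk] cardA; rewrite ltnNge; apply/negP => lek.
have [|C [_ sC cardC]] := @exists_card_between V set0 _ k (sub0set (~: separators A)).
  by rewrite cards0.
have /identifyingP/(_ A cardA) := idk C cardC.
by rewrite setI_eq0 disjoint_sym disjoints_subset sC.
Qed.

End Separators.

(** Pascal's rule, with pairs and singletons as the two summands. *)
Lemma card_small_nonempty (V : finType) :
  #|[set A : {set V} | (0 < #|A| <= 2)%N]| = 'C(#|V|.+1, 2).
Proof.
have -> : [set A : {set V} | (0 < #|A| <= 2)%N] =
    [set A : {set V} | #|A| == 2%N] :|: [set A : {set V} | #|A| == 1%N].
  by apply/setP => A; rewrite !inE; case: #|A| => [|[|[]]].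
rewrite cardsU !card_draws binS [_ :&: _](_ : _ = set0) ?cards0 ?subn0 //.
by apply/setP => A; rewrite !inE; case: #|A| => [|[|[]]].
Qed.

Lemma expn_gt_of_log (R : realType) (N n m s : nat) :
    (0 < N)%N -> (0 < m < n)%N ->
    ln (N%:R : R) / ln (n%:R / m%:R) < s%:R ->
  (N * m ^ s < n ^ s)%N.
Proof.
move=> N0 /andP[m0 mn].
have mR0 : 0 < m%:R :> R by rewrite ltr0n.
have nm1 : 1 < n%:R / m%:R :> R by rewrite ltr_pdivlMr // mul1r ltr_nat.
have nm0 := lt_trans ltr01 nm1.
(* Since [n / m > 1], its logarithm is positive and clearing the denominator keeps the direction of
   the inequality. *)
rewrite ltr_pdivrMr ?ln_gt0 // [s%:R * _]mulr_natl -lnXn //.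
rewrite ltr_ln ?posrE ?exprn_gt0 ?ltr0n //.
by rewrite expr_div_n ltr_pdivlMr ?exprn_gt0 // -!natrX -natrM ltr_nat.
Qed.

Theorem theorem32 (R : realType) (V : finType) (G : sgraph V) (n k : nat)
    (hG : in_Gr G n k) (hk : (2 <= k)%N) (s : int)
    (hs : ln ('C(n.+1, 2)%:R : R) / ln (n%:R / (k%:R - 1)) < s%:~R)
    (hsn : s <= n%:Z) :
  exists2 C : {set V}, #|C|%:Z = s & identifying G C.
Proof.
have [/andP[_ lekn] cardV _] := hG.
have k1n : (0 < k.-1 < n)%N by case: (k) hk lekn => [|[]].
have bin0 : (0 < 'C(n.+1, 2))%N.
  by rewrite bin_gt0 ltnS (leq_trans _ lekn) // (leq_trans _ hk).
have kE : k%:R - 1 = k.-1%:R :> R.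
  by rewrite -[in LHS](prednK (ltnW hk)) -natr1 addrK.
rewrite kE in hs.
(* The lower bound on [s] is a quotient of logarithms of numbers at least 1, hence nonnegative; this
   makes [s] a natural number. *)
have s_ge0 : 0 <= s.
  rewrite -(ler0z R) ltW // (le_lt_trans _ hs) // divr_ge0 // ln_ge0 ?ler1n //.
  by rewrite ler_pdivlMr ?ltr0n ?mul1r ?ler_nat; case/andP: k1n => // _ /ltnW.
case: s s_ge0 hs hsn => // s _ hs; rewrite lez_nat => hsn.
have [i||| C cardC hit] := @exists_hitting_set _ V
    [set A : {set V} | (0 < #|A| <= 2)%N] (separators G) k.-1 s.
- by rewrite inE => /(card_separatorsC hG); rewrite -[in ltnRHS](prednK (ltnW hk)).
- by rewrite card_small_nonempty cardV; apply: expn_gt_of_log hs.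
- by rewrite cardV.
exists C; first by rewrite cardC.
by apply/identifyingP => A cardA; apply: hit; rewrite inE.
Qed.
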